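(* Let $\Omega\subset\mathbb{R}^d$ be open and bounded, and let $F:\bar\Omega\times\mathbb{R}\times\mathbb{R}^d\times S^d\to\mathbb{R}$ be degenerate elliptic, with Dirichlet boundary conditions included in $F$ (i.e. $F(x,r,p,M)=r-g(x)$ for $x\in\partial\Omega$, where $g:\partial\Omega\to\mathbb{R}$ is given). Assume that the equation $F(x,u,\nabla u,D^2u)=0$ on $\bar\Omega$ satisfies the comparison principle, and let $u$ be its unique viscosity solution. Let $(F^\epsilon)_{\epsilon>0}$ be an approximation scheme that is consistent with this equation and nearly monotone. For each $\epsilon>0$ let $u^\epsilon\in C(\bar\Omega)$ be a solution of the scheme, i.e. $F^\epsilon[u^\epsilon](x)=0$ for all $x\in\bar\Omega$, and suppose that the family $(u^\epsilon)_{\epsilon>0}$ is stable, i.e. bounded on $\bar\Omega$ uniformly in $\epsilon$. Then $$u^\epsilon\to u\quad\text{locally uniformly on }\bar\Omega\text{ as }\epsilon\to0.$$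
   Context: $S^d$ is the set of symmetric $d\times d$ real matrices; $X\ge Y$ means $X-Y$ is positive semidefinite. **Degenerate elliptic:** $F(x,r,p,X)\le F(x,s,p,Y)$ for all $x\in\bar\Omega$, $r,s\in\mathbb{R}$, $p\in\mathbb{R}^d$, $X,Y\in S^d$ with $X\ge Y$ and $r\le s$. **Envelopes:** $F^*$ and $F_*$ denote the upper and lower semicontinuous envelopes of $F$ on $\bar\Omega\times\mathbb{R}\times\mathbb{R}^d\times S^d$: $F^*(z)=\limsup_{w\to z}F(w)$, $F_*(z)=\liminf_{w\to z}F(w)$ (with values in the extended reals; $w=z$ is allowed). **Test functions:** ''smooth function'' means $\phi\in C^2(\bar\Omega)$ (restrictions to $\bar\Omega$ of $C^2$ functions on $\mathbb{R}^d$). **Viscosity solutions:** An upper (resp. lower) semicontinuous function $u:\bar\Omega\to\mathbb{R}$ is a viscosity subsolution (resp. supersolution) if for every $\phi\in C^2(\bar\Omega)$, whenever $u-\phi$ has a local maximum (resp. minimum), relative to $\bar\Omega$, at $x\in\bar\Omega$, then $F_*(x,u(x),\nabla\phi(x),D^2\phi(x))\le0$ (resp. $F^*(x,u(x),\nabla\phi(x),D^2\phi(x))\ge0$). A viscosity solution is a function that is both a sub- and a supersolution. **Comparison principle:** if $v\in \mathrm{USC}(\bar\Omega)$ is a viscosity subsolution and $w\in \mathrm{LSC}(\bar\Omega)$ is a viscosity supersolution, then $v\le w$ on $\bar\Omega$. **Approximation scheme:** a family of functions $F^\epsilon$, $\epsilon>0$, assigning a real number $F^\epsilon(x,r,v(\cdot))$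 to each $x\in\bar\Omega$, $r\in\mathbb{R}$ and bounded function $v:\bar\Omega\to\mathbb{R}$. Write $F^\epsilon[v](x)=F^\epsilon(x,v(x),v(\cdot))$. **Consistent:** for every smooth $\phi$ and $x\in\bar\Omega$, $$\limsup_{\epsilon\to0,\,y\to x,\,\xi\to0}F^\epsilon(y,\phi(y)+\xi,\phi(\cdot)+\xi)\le F^*(x,\phi(x),\nabla\phi(x),D^2\phi(x)),$$ $$\liminf_{\epsilon\to0,\,y\to x,\,\xi\to0}F^\epsilon(y,\phi(y)+\xi,\phi(\cdot)+\xi)\ge F_*(x,\phi(x),\nabla\phi(x),D^2\phi(x)),$$ with $y\in\bar\Omega$ and $\xi\in\mathbb{R}$. **Monotone:** a scheme $F_M^\epsilon$ is monotone if for every $\epsilon>0$, $x\in\bar\Omega$, $s\in\mathbb{R}$ and bounded $v,w$ with $v\ge w$ on $\bar\Omega$, one has $F_M^\epsilon(x,s,v(\cdot))\le F_M^\epsilon(x,s,w(\cdot))$. **Perturbation:** a scheme $F_N^\epsilon$ is a perturbation if there is $m:\mathbb{R}^+\to\mathbb{R}^+$, $m\ge 0$, with $\lim_{\epsilon\to0^+}m(\epsilon)=0$ and $\sup_{v}\sup_{x\in\bar\Omega}|F_N^\epsilon[v](x)|\le m(\epsilon)$, the first supremum being over all bounded $v$. **Nearly monotone:** $F^\epsilon$ is nearly monotone if $F^\epsilon[v]=F_M^\epsilon[v]+F_N^\epsilon[v]$ for all bounded $v$, with $F_M^\epsilon$ monotone and $F_N^\epsilon$ a perturbation. *)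

(* Defs.v *)
From HB Require Import structures.
From mathcomp Require Import all_boot all_order all_algebra.
From mathcomp Require Import all_classical all_reals all_analysis.

Set Implicit Arguments.
Unset Strict Implicit.
Unset Printing Implicit Defensive.

Import Order.TTheory GRing.Theory Num.Theory.
Import numFieldNormedType.Exports.

Local Open Scope classical_set_scope.
Local Open Scope ring_scope.

(* Functions on the closure of Omega are functions on the subtype
   [set_type (closure Omega)], with its subspace topology; in particular a
   scheme only sees the values of its argument on that closure. *)

Section Calculus.
Context {R : realType} {d : nat}.
Implicit Types (phi : 'rV[R]_d -> R) (X Y : 'M[R]_d).

Definition symmx : set 'M[R]_d := [set X | X^T = X].

Definition psdmx X := forall v : 'rV[R]_d, 0 <= (v *m X *m v^T) 0 0.

Definition partial (i : 'I_d) phi : 'rV[R]_d -> R :=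
  fun x => 'D_(delta_mx 0 i) phi x.

Definition grad phi x : 'rV[R]_d := \row_i partial i phi x.

Definition hess phi x : 'M[R]_d := \matrix_(i, j) partial j (partial i phi) x.

Definition C1 phi :=
  continuous phi /\
  forall i, (forall x, derivable phi x (delta_mx 0 i)) /\
            continuous (partial i phi).

Definition C2 phi := C1 phi /\ forall i, C1 (partial i phi).

Definition boundary (A : set 'rV[R]_d) : set 'rV[R]_d :=
  closure A `\` interior A.

End Calculus.

Section Equation.
Context {R : realType} {d : nat} {Omega : set 'rV[R]_d}.

(* S^d is represented by [symmx]: F is only used at symmetric matrices, the
   envelopes are limits within them, and the Hessian of a C2 function is
   symmetric. *)
Context (F : closure Omega -> R -> 'rV[R]_d -> 'M[R]_d -> R).

Definition degenerate_elliptic :=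
  forall x r s p X Y, symmx X -> symmx Y -> psdmx (X - Y) -> r <= s ->
    F x r p X <= F x s p Y.

Definition dirichlet (g : boundary Omega -> R) :=
  forall (x : closure Omega) (b : boundary Omega), set_val x = set_val b ->
    forall r p X, symmx X -> F x r p X = r - g b.

Definition uncurryF (w : closure Omega * R * 'rV[R]_d * 'M[R]_d) : \bar R :=
  let: (x, r, p, X) := w in (F x r p X)%:E.

Definition nbhs_sym (x : closure Omega) (r : R) (p : 'rV[R]_d) (X : 'M[R]_d) :=
  within [set w : closure Omega * R * 'rV[R]_d * 'M[R]_d | symmx w.2]
    (nbhs (x, r, p, X)).

Definition upper_env x r p X : \bar R := limf_esup uncurryF (nbhs_sym x r p X).

Definition lower_env x r p X : \bar R := limf_einf uncurryF (nbhs_sym x r p X).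

Definition lsc (u : closure Omega -> R) :=
  lower_semicontinuous (fun x => (u x)%:E).

Definition usc (u : closure Omega -> R) := lsc (fun x => - u x).

Definition local_max (f : closure Omega -> R) x := \forall y \near x, f y <= f x.

Definition local_min (f : closure Omega -> R) x := \forall y \near x, f x <= f y.

Definition subsolution (u : closure Omega -> R) :=
  usc u /\
  forall phi, C2 phi -> forall x : closure Omega,
    local_max (fun y => u y - phi (set_val y)) x ->
    (lower_env x (u x) (grad phi (set_val x)) (hess phi (set_val x)) <= 0)%E.

Definition supersolution (u : closure Omega -> R) :=
  lsc u /\
  forall phi, C2 phi -> forall x : closure Omega,
    local_min (fun y => u y - phi (set_val y)) x ->
    (0 <= upper_env x (u x) (grad phi (set_val x)) (hess phi (set_val x)))%E.

Definition viscosity_solution u := subsolution u /\ supersolution u.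

Definition comparison_principle :=
  forall v w, subsolution v -> supersolution w -> forall x, v x <= w x.

End Equation.

Section Scheme.
Context {R : realType} {d : nat} {Omega : set 'rV[R]_d}.

(* [G e x r v] is only ever used for e > 0 and bounded v. *)
Definition scheme := R -> closure Omega -> R -> (closure Omega -> R) -> R.

Definition apply_scheme (G : scheme) (e : R) (v : closure Omega -> R) :
  closure Omega -> R := fun x => G e x (v x) v.

Definition consistent F (G : scheme) :=
  forall phi, C2 phi -> forall x : closure Omega,
    let Gphi (w : R * closure Omega * R) : \bar R :=
      let: (e, y, xi) := w in
      (G e y (phi (set_val y) + xi) (fun z => phi (set_val z) + xi))%:E in
    let lim_filter := filter_prod (filter_prod 0^'+ (nbhs x)) (nbhs 0) in
    let px := set_val x in
    (limf_esup Gphi lim_filter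
       <= upper_env F x (phi px) (grad phi px) (hess phi px))%E /\
    (lower_env F x (phi px) (grad phi px) (hess phi px)
       <= limf_einf Gphi lim_filter)%E.

Definition monotone_scheme (G : scheme) :=
  forall e : R, 0 < e -> forall x s (v w : closure Omega -> R),
    bounded_fun v -> bounded_fun w ->
    (forall y, w y <= v y) -> G e x s v <= G e x s w.

Definition perturbation (G : scheme) :=
  exists m : R -> R,
    [/\ forall e : R, 0 < e -> 0 <= m e,
        m @ 0^'+ --> 0 &
        forall e : R, 0 < e -> forall v : closure Omega -> R, bounded_fun v ->
          forall x, `|apply_scheme G e v x| <= m e].

Definition nearly_monotone (G : scheme) :=
  exists GM GN : scheme,
    [/\ monotone_scheme GM, perturbation GN &
        forall e : R, 0 < e -> forall v : closure Omega -> R, bounded_fun v ->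
          forall x, apply_scheme G e v x =
                    apply_scheme GM e v x + apply_scheme GN e v x].

Definition stable (ue : R -> closure Omega -> R) :=
  exists M : R, forall e : R, 0 < e -> forall x, `|ue e x| <= M.

Definition cvg_locally_uniformly
    (ue : R -> closure Omega -> R) (u : closure Omega -> R) :=
  forall x : closure Omega, exists2 U, nbhs x U & {uniform U, ue @ 0^'+ --> u}.

End Scheme.
Arguments scheme {R d} Omega.

(* Main.v *)
Require Import Defs.
From HB Require Import structures.
From mathcomp Require Import all_boot all_order all_algebra.
From mathcomp Require Import all_classical all_reals all_analysis.
From mathcomp Require Import lra.

Set Implicit Arguments.
Unset Strict Implicit.
Unset Printing Implicit Defensive.

Import Order.TTheory GRing.Theory Num.Theory.
Import numFieldNormedType.Exports.

Local Open Scope classical_set_scope.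
Local Open Scope ring_scope.

(** Half-relaxed limits (Barles--Souganidis). It suffices to test the upper
    relaxed limit of the u^eps with functions phi touching it strictly from
    above at x: a large multiple of the quartic sum_i (z_i - x_i)^4 makes any
    local maximum strict and global without changing the gradient and the
    Hessian. Then for arbitrarily small eps, phi + xi touches u^eps from above
    near x for some small constant xi; near monotonicity turns F^eps[u^eps] = 0
    into an upper bound 2 m(eps) for the scheme at phi + xi, and consistency
    makes the upper relaxed limit a subsolution. The substitution
    (r, p, X) -> (-r, -p, -X) exchanges sub- and supersolutions, so the lower
    relaxed limit is a supersolution. Comparison with u squeezes both onto u,
    and compactness of the closure makes the convergence uniform. *)

Lemma compact_set_type (X : topologicalType) (A : set X) :
  compact A -> compact [set: A].
Proof.
move=> cptA F FF _.
have FA : (set_val @ F) A.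
  suff : F (set_val @^-1` A) by [].
  by apply: filterE => x; exact: set_valP.
have [a [Aa clusterFa]] := cptA (set_val @ F) _ FA.
exists (exist _ a (mem_set Aa)); split=> // U V FU [_ [[W openW <-] Wa WV]].
have FvalU : F (set_val @^-1` (set_val @` U)).
  by apply: filterS FU => x Ux; exists x.
have [|_ [[y Uy <-] Wy]] := clusterFa _ W FvalU; first exact: open_nbhs_nbhs.
by exists y; split=> //; exact: WV.
Qed.

Lemma continuous_comp_set_val (X Y : topologicalType) (A : set X) (f : X -> Y) :
  continuous f -> continuous (fun x : A => f (set_val x)).
Proof.
move=> cf x; apply: continuous_comp; last exact: cf.
exact: (@initial_continuous A X set_val).
Qed.

Lemma bounded_set_closure (R : realType) (V : normedModType R) (A : set V) :
  bounded_set A -> bounded_set (closure A).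
Proof.
move=> [M [Mreal AM]]; exists M; split=> // r /AM Ar.
suff : closure A `<=` [set x | `|x| <= r] by [].
have /closure_id -> : closed [set x : V | `|x| <= r].
  apply: (@preimage_closed V R Num.norm [set t | t <= r]).
    by move=> x _; exact: norm_continuous.
  exact: closed_le.
exact: closure_subset.
Qed.

Lemma compact_closure_type (R : realType) (d : nat) (A : set 'rV[R]_d) :
  bounded_set A -> compact [set: closure A].
Proof.
move=> bndA; apply: compact_set_type; apply: bounded_closed_compact.
  exact: bounded_set_closure.
exact: closed_closure.
Qed.

Lemma bounded_fun_leP (R : realType) (T : Type) (f : T -> R) :
  bounded_fun f <-> exists B, forall x, `|f x| <= B.
Proof.
split=> [[B [_ fB]]|[B fB]].
  by exists (B + 1) => x; apply: fB => //; rewrite ltrDl.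
exists B; split=> [|C BC x _]; first exact: num_real.
exact: le_trans (fB x) (ltW BC).
Qed.

Lemma continuous_lower_semicontinuous (R : realType) (T : topologicalType)
    (f : T -> R) :
  continuous f -> lower_semicontinuous (fun x => (f x)%:E).
Proof.
move=> cf x a; rewrite lte_fin => afx.
by exists [set y | a < f y] => //; exact: (cvgr_gt _ (cf x)).
Qed.

Lemma compact_bounded_fun (R : realType) (T : topologicalType) (f : T -> R) :
  compact [set: T] -> continuous f -> bounded_fun f.
Proof.
move=> cptT cf.
have /compact_bounded : compact (f @` [set: T]).
  by apply: continuous_compact cptT; exact: continuous_subspaceT.
move=> [B [Breal fB]]; exists B; split=> // r /fB fr x _.
by apply: fr; exists x.
Qed.

Lemma cvg_filter_prod (T U T' U' : Type) (F : set_system T) (G : set_system U)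
    (F' : set_system T') (G' : set_system U') {FF : Filter F} {FG : Filter G}
    {FF' : Filter F'} {FG' : Filter G'} (f : T -> T') (g : U -> U') :
  f @ F --> F' -> g @ G --> G' ->
  (fun w => (f w.1, g w.2)) @ filter_prod F G --> filter_prod F' G'.
Proof.
move=> fF gG; apply: cvg_pair; first exact: cvg_comp cvg_fst fF.
exact: cvg_comp cvg_snd gG.
Qed.

Section LimfComp.
Context {R : realType} {T U : choiceType}.
Context {X : filteredType T} {Y : filteredType U}.
Implicit Types (F : set_system X) (G : set_system Y) (f : Y -> \bar R).

Lemma le_limf_esup_comp f (h : X -> Y) F G :
  h @ F --> G -> (limf_esup (f \o h) F <= limf_esup f G)%E.
Proof.
move=> hFG; apply: le_ereal_inf_tmp => _ [V GV <-].
apply: (@le_trans _ _ (ereal_sup ((f \o h) @` (h @^-1` V)))).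
  by apply: ereal_inf_lbound; exists (h @^-1` V) => //; exact: hFG.
by apply: le_ereal_sup => _ [x Vhx <-]; exists (h x).
Qed.

Lemma limf_einf_le f G (a : \bar R) :
  (forall A, G A -> exists2 y, A y & (f y <= a)%E) -> (limf_einf f G <= a)%E.
Proof.
move=> fle; rewrite limf_einfE; apply: ge_ereal_sup => _ [A /fle[y Ay fya] <-].
by apply: le_trans fya; apply: ereal_inf_lbound; exists y.
Qed.

End LimfComp.

Section LimfCancel.
Context {R : realType} {T U : choiceType}.
Context {X : filteredType T} {Y : filteredType U}.
Variables (h : X -> Y) (k : Y -> X) (F : set_system X) (G : set_system Y).
Hypotheses (kK : cancel k h) (hFG : h @ F --> G) (kGF : k @ G --> F).
Implicit Type f : Y -> \bar R.

Lemma limf_esup_comp f : limf_esup (f \o h) F = limf_esup f G.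
Proof.
apply/eqP; rewrite eq_le le_limf_esup_comp//=.
have {1}-> : f = (f \o h) \o k by apply/funext => y /=; rewrite kK.
exact: le_limf_esup_comp.
Qed.

Lemma limf_einf_comp f : limf_einf (f \o h) F = limf_einf f G.
Proof. by rewrite /limf_einf -limf_esup_comp. Qed.

End LimfCancel.

Section RelaxedLimits.
Context {R : realType} {T : topologicalType} {J : Type}.
Variable F : set_system J.

(* [inf] is 0 on sets that are empty or unbounded below, so this is the upper
   relaxed limit only for families that are bounded along [F]. *)
Definition relaxed_limsup (v : J -> T -> R) (x : T) : R :=
  inf [set a | \forall i \near F & y \near x, v i y <= a].

Definition relaxed_liminf (v : J -> T -> R) (x : T) : R :=
  - relaxed_limsup (fun i y => - v i y) x.

End RelaxedLimits.

Section RelaxedLimsupTheory.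
Context {R : realType} {T : topologicalType} {J : Type}.
Context {F : set_system J} {FF : ProperFilter F}.
Variables (v : J -> T -> R) (M : R).
Hypothesis v_le : \forall i \near F, forall x, `|v i x| <= M.
Local Notation vbar := (relaxed_limsup F v).
Implicit Types (x : T) (a : R) (f : T -> R).

Let near_v_le x : \forall i \near F & y \near x, - M <= v i y <= M.
Proof.
apply: filterS (filter_prod1 v_le) => -[i y] /= /(_ y).
by rewrite ler_norml.
Qed.

Let relaxed_limsup_has_inf x :
  has_inf [set a | \forall i \near F & y \near x, v i y <= a].
Proof.
split; first by exists M; apply: filterS (near_v_le x) => w /andP[].
exists (- M) => a /= va.
have [w [va_w /andP[Mv _]]] := filter_ex (filterI va (near_v_le x)).
exact: le_trans Mv va_w.
Qed.

Lemma relaxed_limsup_lt x a :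
  vbar x < a -> \forall i \near F & y \near x, v i y < a.
Proof.
move=> /(inf_lt (proj1 (relaxed_limsup_has_inf x)))[b vb ba].
by apply: filterS vb => w /= /le_lt_trans; exact.
Qed.

Lemma relaxed_limsup_le x a :
  (\forall i \near F & y \near x, v i y <= a) -> vbar x <= a.
Proof. by move=> va; apply: ge_inf => //; case: (relaxed_limsup_has_inf x). Qed.

Lemma lt_relaxed_limsup x a P : a < vbar x ->
  (\forall i \near F & y \near x, P i y) -> exists i y, P i y /\ a < v i y.
Proof.
move=> a_lt nearP; apply: contrapT => noPa.
suff /relaxed_limsup_le : \forall i \near F & y \near x, v i y <= a.
  by rewrite leNgt a_lt.
apply: filterS nearP => -[i y] Piy /=; rewrite leNgt; apply/negP => av.
by apply: noPa; exists i, y.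
Qed.

Lemma normr_relaxed_limsup x : `|vbar x| <= M.
Proof.
rewrite ler_norml; apply/andP; split.
  apply: lb_le_inf => [|a va]; first by case: (relaxed_limsup_has_inf x).
  have [w [va_w /andP[Mv _]]] := filter_ex (filterI va (near_v_le x)).
  exact: le_trans Mv va_w.
by apply: relaxed_limsup_le; apply: filterS (near_v_le x) => w /andP[].
Qed.

Lemma relaxed_limsup_usc : lower_semicontinuous (fun x => (- vbar x)%:E).
Proof.
move=> x a; rewrite lte_fin ltrNr => xa.
have [xb ba] := midf_lt xa; set b := (_ / _) in xb ba.
have [[P V] [/= FP Vx] v_lt] := relaxed_limsup_lt xb.
exists (interior V); first exact: nbhs_interior.
move=> y Vy; rewrite lte_fin ltrNr; apply: le_lt_trans ba.
by apply: relaxed_limsup_le; exists (P, V) => // w /v_lt /ltW.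
Qed.

Lemma relaxed_limsup_compact_lt (K : set T) f :
  compact K -> lower_semicontinuous (fun x => (f x)%:E) ->
  (forall x, K x -> vbar x < f x) ->
  exists2 d, 0 < d & \forall i \near F, forall x, K x -> v i x + d < f x.
Proof.
move=> /compact_near_coveringP cptK lscf vbar_lt.
suff [[P D] [/= FP D0] PDK] : \forall i \near F & d \near (0 : R)^'+,
    K `<=` [set x | v i x + d < f x].
  have [d [d0 Dd]] := filter_ex (filterI (nbhs_right_gt 0) D0).
  by exists d => //; apply: filterS FP => i Pi; exact: (PDK (i, d)).
apply: (cptK _ (filter_prod F 0^'+) (fun w => [set x | v w.1 x + w.2 < f x])).
move=> x /vbar_lt xf.
have [xa af] := midf_lt xf; set a := (_ / _) in xa af.
have [ab bf] := midf_lt af; set b := (_ / _) in ab bf.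
have [[P V] [/= FP Vx] v_lt] := relaxed_limsup_lt xa.
have [W Wx f_gt] := lscf x b bf.
exists (V `&` W, P `*` [set d | d < b - a]) => /=.
  split; first exact: filterI.
  by exists (P, [set d | d < b - a]) => //; split=> //; apply: nbhs_right_lt;
     rewrite subr_gt0.
move=> [y [i d]] /= [[Vy Wy] [Pi d_lt]].
have := v_lt (i, y) (conj Pi Vy); have := f_gt y Wy.
by rewrite /= lte_fin; lra.
Qed.

Lemma relaxed_limsup_uniform_lt f (delta : R) :
  compact [set: T] -> lower_semicontinuous (fun x => (f x)%:E) ->
  (forall x, vbar x <= f x) -> 0 < delta ->
  \forall i \near F, forall x, v i x < f x + delta.
Proof.
move=> cptT lscf vbar_le delta0.
have [||d d0] := @relaxed_limsup_compact_lt setT (fun x => f x + delta) cptT.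
- move=> x a; rewrite lte_fin -ltrBlDr => /lscf[V Vx f_gt].
  by exists V => // y /f_gt; rewrite !lte_fin ltrBlDr.
- by move=> x _; rewrite (le_lt_trans (vbar_le x))// ltrDl.
by apply: filterS => i v_lt x; have := v_lt x I; lra.
Qed.

Lemma relaxed_limsup_strict_lt f x V h :
  compact [set: T] -> lower_semicontinuous (fun z => (f z)%:E) ->
  vbar x = f x -> (forall y, y != x -> vbar y < f y) -> nbhs x V -> 0 < h ->
  exists2 d, 0 < d & \forall i \near F,
    (forall z, ~ V z -> v i z + d < f z) /\ (forall z, v i z < f z + h).
Proof.
move=> cptT lscf vfx vf_lt Vx h0.
have vbar_le y : vbar y <= f y.
  by have [->|/vf_lt/ltW] := eqVneq y x; rewrite ?vfx.
have [|y Vy|d d0 far] := @relaxed_limsup_compact_lt (~` interior V) f _ lscf.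
- apply: subclosed_compact cptT _ => //.
  by apply: open_closedC; exact: open_interior.
- by apply: vf_lt; apply: contra_not_neq Vy => ->.
exists d => //.
apply: filterS2 far (relaxed_limsup_uniform_lt cptT lscf vbar_le h0).
move=> i far_i near_i; split=> // z Vz; apply: far_i.
by move=> /interior_subset.
Qed.

(* The maximum points of [v i - f] accumulate only at the strict maximum [x] of
   [vbar - f], and the maximal values tend to [vbar x - f x = 0]. *)
Lemma relaxed_limsup_strict_max f x P :
  compact [set: T] -> (\forall i \near F, continuous (v i)) -> continuous f ->
  vbar x = f x -> (forall y, y != x -> vbar y < f y) ->
  filter_prod (filter_prod F (nbhs x)) (nbhs (0 : R)) P ->
  exists i y xi,
    [/\ P (i, y, xi), v i y = f y + xi & forall z, v i z <= f z + xi].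
Proof.
move=> cptT cv cf vfx vf_lt [[A B] [/= [[D V] [/= FD Vx] DVA]]].
move=> /nbhs_ballP[h /= h0 hB] ABP.
have [d d0 v_lt] := relaxed_limsup_strict_lt cptT
  (continuous_lower_semicontinuous cf) vfx vf_lt Vx h0.
pose r := Num.min d h; have r0 : 0 < r by rewrite lt_min d0.
pose good := [set i | [/\ D i, continuous (v i),
  forall z, ~ V z -> v i z + d < f z & forall z, v i z < f z + h]].
have near_good : \forall i \near F, good i.
  by apply: filterS3 FD cv v_lt => i Di cvi [].
have near_x : \forall i \near F & y \near x, good i /\ f y < f x + r / 2.
  exists (good, [set y | f y < f x + r / 2]) => //; split=> //=.
  by apply: (cvgr_lt _ (cf x)); lra.
have [|i [y0 [[[Di cvi far_i near_i] fy0] vy0]]] :=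
  lt_relaxed_limsup (a := f x - r / 2) _ near_x; first by rewrite vfx; lra.
have cvf : continuous (v i \- f).
  by move=> z; apply: cvgB; [exact: cvi|exact: cf].
have [|y _ ymax] := compact_EVT_max _ cptT (continuous_subspaceT cvf).
  by exists x.
have {}ymax z : v i z - f z <= v i y - f y by apply: ymax; exact/mem_set.
have y_gt : - r < v i y - f y by have := ymax y0; lra.
have [rd rh] : r <= d /\ r <= h by rewrite !ge_min !lexx orbT.
exists i, y, (v i y - f y); split; last 2 first.
- by rewrite subrKC.
- by move=> z; rewrite -lerBlDl.
apply: ABP; split=> /=.
  by apply: DVA; split=> //=; apply: contrapT => /far_i; lra.
apply: hB; rewrite /ball /= sub0r normrN ltr_norml.
by have := near_i y; lra.
Qed.

End RelaxedLimsupTheory.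

Lemma cvg_uniform_relaxed (R : realType) (T : topologicalType) (J : Type)
    (F : set_system J) {FF : ProperFilter F} (v : J -> T -> R) (f : T -> R)
    (M : R) :
  compact [set: T] -> (\forall i \near F, forall x, `|v i x| <= M) ->
  lower_semicontinuous (fun x => (f x)%:E) ->
  lower_semicontinuous (fun x => (- f x)%:E) ->
  (forall x, relaxed_limsup F v x <= f x) ->
  (forall x, f x <= relaxed_liminf F v x) ->
  {uniform [set: T], v @ F --> f}.
Proof.
move=> cptT v_le lscf uscf limsup_le le_liminf P /uniform_nbhs[E [entE EP]].
move: entE; rewrite -entourage_ballE => -[delta /= delta0 deltaE].
have Nv_le : \forall i \near F, forall x, `|- v i x| <= M.
  by apply: filterS v_le => i vi x; rewrite normrN.
have v_lt : \forall i \near F, forall x, v i x < f x + delta.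
  by apply: (relaxed_limsup_uniform_lt v_le).
have v_gt : \forall i \near F, forall x, - v i x < - f x + delta.
  apply: (relaxed_limsup_uniform_lt Nv_le) => // x.
  by rewrite lerNr; exact: le_liminf.
suff : F (v @^-1` P) by [].
apply: filterS2 v_lt v_gt => i vi_lt vi_gt.
apply: EP => y _; apply: deltaE; rewrite /= /ball /= ltr_norml.
by have := vi_lt y; have := vi_gt y; lra.
Qed.

Section Penalty.
Context {R : realType} {T : topologicalType}.
Implicit Types (w q : T -> R) (x : T).

Definition penalty x q :=
  [/\ q x = 0, forall y, y != x -> 0 < q y &
      forall U, nbhs x U -> exists2 r, 0 < r & forall y, q y < r -> U y].

Lemma penalized_strict_max w q x : bounded_fun w -> penalty x q ->
  (\forall y \near x, w y <= w x) ->
  exists K, forall y, y != x -> w y < w x + K * q y.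
Proof.
move=> /bounded_fun_leP[B wB] [_ q_gt0 q_nbhs] /q_nbhs[r r0 wmax].
have B0 : 0 <= B by exact: le_trans (wB x).
exists (2 * B / r + 1) => y /q_gt0 qy.
rewrite mulrDl mul1r addrCA -ltrBlDl.
have [/wmax/=|rq] := ltP (q y) r.
  have : 0 <= 2 * B / r * q y by rewrite !mulr_ge0// ?invr_ge0 ltW.
  lra.
have : 2 * B <= 2 * B / r * q y.
  rewrite -mulrA ler_peMr ?mulr_ge0//.
  by rewrite mulrC ler_pdivlMr ?mul1r.
by move: (wB y) (wB x); rewrite !ler_norml; lra.
Qed.

End Penalty.

Lemma penalty_set_val (R : realType) (T : topologicalType) (A : set T) (x : A)
    (q : T -> R) :
  penalty (set_val x) q -> penalty x (fun y : A => q (set_val y)).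
Proof.
move=> [qx q_gt0 q_nbhs]; split=> // [y yx|U].
  by apply: q_gt0; apply: contra yx => /eqP/val_inj ->.
move=> [_ [[W openW <-] Wx WU]].
have [|r r0 rW] := q_nbhs W; first exact: open_nbhs_nbhs.
by exists r => // y /rW; exact: WU.
Qed.

Section C2Calculus.
Context {R : realType} {d : nat}.
Implicit Types (f g : 'rV[R]_d -> R) (x z : 'rV[R]_d) (k : R) (i j : 'I_d).

Lemma gradE f x i : grad f x 0 i = partial i f x.
Proof. by rewrite mxE. Qed.

Lemma hessE f x i j : hess f x i j = partial j (partial i f) x.
Proof. by rewrite mxE. Qed.

Lemma partialD f g i : C1 f -> C1 g ->
  partial i (f + g) = partial i f + partial i g.
Proof.
move=> [_ /(_ i)[df _]] [_ /(_ i)[dg _]]; apply/funext => x.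
exact: deriveD.
Qed.

Lemma partialZ k f i : C1 f -> partial i (k *: f) = k *: partial i f.
Proof.
move=> [_ /(_ i)[df _]]; apply/funext => x.
exact: (deriveZ k (df x)).
Qed.

Lemma partial_cst k i : partial i (cst k) = cst 0.
Proof. by apply/funext => x; exact: derive_cst. Qed.

Lemma C1_cst k : C1 (cst k : 'rV[R]_d -> R).
Proof.
split=> [|i]; first exact: cst_continuous.
rewrite partial_cst; split=> [x|]; first exact: derivable_cst.
exact: cst_continuous.
Qed.

Lemma C1D f g : C1 f -> C1 g -> C1 (f + g).
Proof.
move=> Cf Cg; have [cf df] := Cf; have [cg dg] := Cg; split.
  by move=> x; exact: (cvgD (cf x) (cg x)).
move=> i; have [dfi cfi] := df i; have [dgi cgi] := dg i; split.
  by move=> x; exact: derivableD.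
by rewrite partialD// => x; exact: (cvgD (cfi x) (cgi x)).
Qed.

Lemma C1Z k f : C1 f -> C1 (k *: f).
Proof.
move=> Cf; have [cf df] := Cf; split.
  by move=> x; exact: (cvgM (cvg_cst k) (cf x)).
move=> i; have [dfi cfi] := df i; split.
  by move=> x; exact: derivableZ.
by rewrite partialZ// => x; exact: (cvgM (cvg_cst k) (cfi x)).
Qed.

Lemma C2_continuous f : C2 f -> continuous f.
Proof. by case=> -[]. Qed.

Lemma C2_cst k : C2 (cst k : 'rV[R]_d -> R).
Proof. by split=> [|i]; rewrite ?partial_cst; exact: C1_cst. Qed.

Lemma C2D f g : C2 f -> C2 g -> C2 (f + g).
Proof.
move=> [Cf Df] [Cg Dg]; split; first exact: C1D.
by move=> i; rewrite (partialD i Cf Cg); exact: C1D (Df i) (Dg i).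
Qed.

Lemma C2Z k f : C2 f -> C2 (k *: f).
Proof.
move=> [Cf Df]; split; first exact: C1Z.
by move=> i; rewrite (partialZ k i Cf); exact: C1Z (Df i).
Qed.

Lemma C2N f : C2 f -> C2 (- f).
Proof. by rewrite -scaleN1r; exact: C2Z. Qed.

Lemma gradD f g x : C2 f -> C2 g -> grad (f + g) x = grad f x + grad g x.
Proof.
move=> [Cf _] [Cg _]; apply/rowP => i.
by rewrite [RHS]mxE !gradE partialD.
Qed.

Lemma gradZ k f x : C2 f -> grad (k *: f) x = k *: grad f x.
Proof. by move=> [Cf _]; apply/rowP => i; rewrite [RHS]mxE !gradE partialZ. Qed.

Lemma gradN f x : C2 f -> grad (- f) x = - grad f x.
Proof. by rewrite -[- f]scaleN1r -[RHS]scaleN1r; exact: gradZ. Qed.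

Lemma hessD f g x : C2 f -> C2 g -> hess (f + g) x = hess f x + hess g x.
Proof.
move=> [Cf Df] [Cg Dg]; apply/matrixP => i j.
rewrite [LHS]hessE (partialD i Cf Cg) (partialD j (Df i) (Dg i)) [RHS]mxE.
by congr (_ + _); rewrite hessE.
Qed.

Lemma hessZ k f x : C2 f -> hess (k *: f) x = k *: hess f x.
Proof.
move=> [Cf Df]; apply/matrixP => i j.
rewrite [LHS]hessE (partialZ k i Cf) (partialZ k j (Df i)) [RHS]mxE.
by congr (_ * _); rewrite hessE.
Qed.

Lemma hessN f x : C2 f -> hess (- f) x = - hess f x.
Proof. by rewrite -[- f]scaleN1r -[RHS]scaleN1r; exact: hessZ. Qed.

Definition flat2 x f := [/\ C2 f, grad f x = 0 & hess f x = 0].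

Lemma flat2_cst k x : flat2 x (cst k).
Proof.
split; first exact: C2_cst.
  by apply/rowP => i; rewrite [RHS]mxE gradE partial_cst.
by apply/matrixP => i j; rewrite [RHS]mxE hessE !partial_cst.
Qed.

Lemma flat2D f g x : flat2 x f -> flat2 x g -> flat2 x (f + g).
Proof.
move=> [Cf gradf hessf] [Cg gradg hessg].
by split; [exact: C2D|rewrite gradD// gradf gradg addr0|
   rewrite hessD// hessf hessg addr0].
Qed.

Lemma flat2Z k f x : flat2 x f -> flat2 x (k *: f).
Proof.
move=> [Cf gradf hessf].
by split; [exact: C2Z|rewrite gradZ// gradf scaler0|
   rewrite hessZ// hessf scaler0].
Qed.

Lemma flat2_sum (I : Type) (s : seq I) (f : I -> 'rV[R]_d -> R) x :
  (forall a, flat2 x (f a)) -> flat2 x (\sum_(a <- s) f a).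
Proof.
move=> flatf; apply: (big_ind (flat2 x)) => [|g h|a _].
- exact: (flat2_cst 0).
- exact: flat2D.
- exact: flatf.
Qed.

Lemma is_derive_coord i v x :
  is_derive x v (fun z : 'rV[R]_d => z 0 i) (v 0 i).
Proof.
apply: DeriveDef; first exact/diff_derivable/differentiable_coord.
rewrite /derive; under eq_fun do rewrite /= !mxE addrK.
have quotient : \forall h \near (0 : R)^', v 0 i = h^-1 *: (h * v 0 i).
  near=> h; rewrite /GRing.scale /= mulKf//.
  by near: h; exact: nbhs_dnbhs_neq.
apply: cvg_lim => //; apply: cvg_trans (near_eq_cvg quotient) _.
exact: cvg_cst.
Unshelve. all: by end_near.
Qed.

Definition coordX i (a : R) n : 'rV[R]_d -> R := fun z => (z 0 i - a) ^+ n.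

Lemma continuous_coordX i a n : continuous (coordX i a n).
Proof.
move=> z; apply: (@continuous_comp _ _ _ (fun z : 'rV[R]_d => z 0 i - a)
  (fun t => t ^+ n)).
  exact: (cvgB (@coord_continuous R _ _ 0 i z) (cvg_cst a)).
exact: exprn_continuous.
Qed.

Lemma is_derive_coordX i a n v x :
  is_derive x v (coordX i a n) (n%:R * v 0 i * coordX i a n.-1 x).
Proof.
have dcoord := is_deriveB (is_derive_coord i v x) (is_derive_cst a x v).
have -> : coordX i a n = ((fun z : 'rV[R]_d => z 0 i) - cst a) ^+ n.
  by apply/funext => z; rewrite exprfctE.
apply: is_derive_eq (is_deriveX n dcoord) _.
by rewrite /GRing.scale /= subr0 mulrAC.
Qed.

Lemma partial_coordX i j a n :
  partial j (coordX i a n) = (n%:R *+ (i == j)) *: coordX i a n.-1.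
Proof.
apply/funext => x; rewrite /partial.
rewrite (@derive_val _ _ _ _ _ _ _ (is_derive_coordX i a n (delta_mx 0 j) x)).
by rewrite mxE eqxx /= mulr_natr.
Qed.

Lemma C1_coordX i a n : C1 (coordX i a n).
Proof.
split=> [|j]; first exact: continuous_coordX.
split=> [x|].
  exact: (@ex_derive _ _ _ _ _ _ _ (is_derive_coordX i a n _ x)).
rewrite partial_coordX => x.
exact: (cvgM (cvg_cst _) (@continuous_coordX i a n.-1 x)).
Qed.

Lemma C2_coordX i a n : C2 (coordX i a n).
Proof.
split=> [|j]; first exact: C1_coordX.
by rewrite partial_coordX; apply: C1Z; exact: C1_coordX.
Qed.

Lemma flat2_coordX i n x : flat2 x (coordX i (x 0 i) n.+3).
Proof.
have coordX0 m : coordX i (x 0 i) m.+1 x = 0.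
  by rewrite /coordX subrr expr0n.
split; first exact: C2_coordX.
  apply/rowP => j; rewrite [RHS]mxE gradE partial_coordX.
  by rewrite fctE coordX0 scaler0.
apply/matrixP => j k; rewrite [RHS]mxE hessE partial_coordX.
rewrite partialZ; last exact: C1_coordX.
by rewrite partial_coordX !fctE coordX0 !scaler0.
Qed.

Definition quartic x : 'rV[R]_d -> R := \sum_i coordX i (x 0 i) 4.

Lemma quarticE x z : quartic x z = \sum_i (z 0 i - x 0 i) ^+ 4.
Proof. by rewrite /quartic fct_sumE. Qed.

Lemma flat2_quartic x : flat2 x (quartic x).
Proof. by apply: flat2_sum => i; exact: flat2_coordX. Qed.

Lemma coord_le_quartic i x z : (z 0 i - x 0 i) ^+ 4 <= quartic x z.
Proof.
rewrite quarticE (bigD1 i)//= lerDl.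
by apply: sumr_ge0 => j _; rewrite exprn_even_ge0.
Qed.

Lemma penalty_quartic x : penalty x (quartic x).
Proof.
split=> [|z zx|U /nbhs_ballP[r /= r0 rU]].
- by rewrite quarticE big1// => i _; rewrite subrr expr0n.
- have [i zxi] : exists i, z 0 i != x 0 i.
    apply: contrapT => zx_eq; move/eqP: zx; apply; apply/rowP => i.
    by apply/eqP/negPn/negP => zxi; apply: zx_eq; exists i.
  apply: lt_le_trans (coord_le_quartic i x z).
  by rewrite exprn_even_gt0//= subr_eq0.
- exists (r ^+ 4) => [|z zr]; first exact: exprn_gt0.
  apply: rU; split=> // i j; rewrite ord1 /ball /=.
  have : `|x 0 j - z 0 j| ^+ 4 < r ^+ 4.
    rewrite distrC -normrX ger0_norm ?exprn_even_ge0//.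
    exact: le_lt_trans (coord_le_quartic j x z) zr.
  by rewrite ltr_pXn2r// nnegrE ltW.
Qed.

End C2Calculus.

Section Viscosity.
Context {R : realType} {d : nat} {Omega : set 'rV[R]_d}.
Variable F : closure Omega -> R -> 'rV[R]_d -> 'M[R]_d -> R.

Lemma subsolution_strict_test (u : closure Omega -> R) :
  bounded_set Omega -> usc u -> bounded_fun u ->
  (forall phi (x : closure Omega), C2 phi -> u x = phi (set_val x) ->
    (forall y : closure Omega, y != x -> u y < phi (set_val y)) ->
    (lower_env F x (u x) (grad phi (set_val x)) (hess phi (set_val x)) <= 0)%E)
  -> subsolution F u.
Proof.
move=> /compact_closure_type cptO uscu bndu strict_test; split=> //.
move=> phi C2phi x umax; pose px := set_val x.
have bndw : bounded_fun (fun y : closure Omega => u y - phi (set_val y)).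
  apply: (bounded_funD bndu); apply: bounded_funN.
  apply: compact_bounded_fun cptO _.
  by apply: continuous_comp_set_val; exact: C2_continuous.
have pen := penalty_set_val (penalty_quartic px).
have [K w_lt] := penalized_strict_max bndw pen umax.
pose q := cst (u x - phi px) + K *: quartic px.
have [C2q gradq hessq] : flat2 px q.
  by apply: flat2D (flat2_cst _ _) _; apply: flat2Z; exact: flat2_quartic.
have qE z : q z = u x - phi px + K * quartic px z by [].
have := strict_test (phi + q) x (C2D C2phi C2q).
rewrite gradD// hessD// gradq hessq !addr0; apply.
  by have [qx _ _] := penalty_quartic px; rewrite fctE qE qx mulr0 addr0 subrKC.
by move=> y /w_lt; rewrite fctE qE /=; lra.
Qed.

End Viscosity.

Section Duality.
Context {R : realType} {d : nat} {Omega : set 'rV[R]_d}.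
Implicit Types (F : closure Omega -> R -> 'rV[R]_d -> 'M[R]_d -> R).
Implicit Types (x : closure Omega) (r : R) (p : 'rV[R]_d) (X : 'M[R]_d).

Definition opp_operator F x r p X := - F x (- r) (- p) (- X).

Lemma opp_operatorK F : opp_operator (opp_operator F) = F.
Proof.
apply/funext => x; apply/funext => r; apply/funext => p; apply/funext => X.
by rewrite /opp_operator !opprK.
Qed.

Let opp_jet (w : closure Omega * R * 'rV[R]_d * 'M[R]_d) :=
  (w.1.1.1, - w.1.1.2, - w.1.2, - w.2).

Let opp_jetK : involutive opp_jet.
Proof. by case=> [[[x r] p] X]; rewrite /opp_jet /= !opprK. Qed.

Let opp_jet_cvg x r p X :
  opp_jet @ nbhs_sym x r p X --> nbhs_sym x (- r) (- p) (- X).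
Proof.
have cvg_jet : opp_jet @ nbhs (x, r, p, X) --> nbhs (x, - r, - p, - X).
  exact: (cvg_filter_prod (cvg_filter_prod (cvg_filter_prod
    (@cvg_id _ (nbhs x)) (@opp_continuous _ r))
    (@opp_continuous _ p)) (@opp_continuous _ X)).
move=> V nearV.
have near_oppV : \forall w \near (x, r, p, X),
    symmx (opp_jet w).2 -> V (opp_jet w) by exact: cvg_jet nearV.
suff : \forall w \near (x, r, p, X), symmx w.2 -> V (opp_jet w) by [].
apply: filterS near_oppV => w Vw symw.
by apply: Vw; rewrite /symmx /= linearN /= symw.
Qed.

Lemma lower_env_opp F x r p X :
  lower_env (opp_operator F) x r p X = (- upper_env F x (- r) (- p) (- X))%E.
Proof.
rewrite /lower_env /upper_env /limf_einf; congr (- _)%E.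
rewrite -(limf_esup_comp opp_jetK (@opp_jet_cvg x r p X)); last first.
  by have := @opp_jet_cvg x (- r) (- p) (- X); rewrite !opprK.
by congr limf_esup; apply/funext => -[[[y s] q] Y]; rewrite /= opprK.
Qed.

Lemma upper_env_opp F x r p X :
  upper_env (opp_operator F) x r p X = (- lower_env F x (- r) (- p) (- X))%E.
Proof. by rewrite -[in RHS](opp_operatorK F) lower_env_opp !opprK oppeK. Qed.

Lemma supersolution_opp F (u : closure Omega -> R) :
  subsolution (opp_operator F) (fun x => - u x) -> supersolution F u.
Proof.
move=> [uscNu testNu]; split.
  by move: uscNu; rewrite /usc; under eq_fun do rewrite opprK.
move=> phi C2phi x umin; have := testNu _ (C2N C2phi) x.
rewrite lower_env_opp gradN// hessN// !opprK oppe_le0; apply.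
by apply: filterS umin => y; rewrite !fctE; lra.
Qed.

Definition opp_scheme (G : scheme Omega) : scheme Omega :=
  fun e x r v => - G e x (- r) (fun y => - v y).

Lemma apply_scheme_opp (G : scheme Omega) e v x :
  apply_scheme (opp_scheme G) e v x = - apply_scheme G e (fun y => - v y) x.
Proof. by []. Qed.

Definition test_value (G : scheme Omega) (phi : 'rV[R]_d -> R)
    (w : R * closure Omega * R) : \bar R :=
  let: (e, y, xi) := w in
  (G e y (phi (set_val y) + xi) (fun z => phi (set_val z) + xi))%:E.

Let opp_shift (w : R * closure Omega * R) := (w.1, - w.2).

Let opp_shiftK : involutive opp_shift.
Proof. by case=> w r; rewrite /opp_shift opprK. Qed.

Let opp_shift_cvg x :
  opp_shift @ filter_prod (filter_prod 0^'+ (nbhs x)) (nbhs 0) -->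
  filter_prod (filter_prod 0^'+ (nbhs x)) (nbhs 0).
Proof.
have opp0 : -%R @ nbhs (0 : R) --> nbhs (0 : R).
  by rewrite -[X in _ --> nbhs X]oppr0; exact: opp_continuous.
exact: (cvg_filter_prod (@cvg_id _ (filter_prod 0^'+ (nbhs x))) opp0).
Qed.

Let test_value_opp (G : scheme Omega) phi :
  test_value (opp_scheme G) phi = (\- (test_value G (- phi)%R \o opp_shift))%E.
Proof.
apply/funext => -[[e y] xi]; rewrite /= /opp_scheme !fctE opprD.
by congr ((- G _ _ _ _)%:E); apply/funext => z; rewrite opprD.
Qed.

Lemma consistent_opp F (G : scheme Omega) :
  consistent F G -> consistent (opp_operator F) (opp_scheme G).
Proof.
move=> consG phi C2phi x /=; rewrite -/(test_value (opp_scheme G) phi).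
have shiftL := @opp_shift_cvg x.
rewrite test_value_opp limf_esupN limf_einfN.
rewrite (limf_esup_comp opp_shiftK shiftL shiftL).
rewrite (limf_einf_comp opp_shiftK shiftL shiftL).
rewrite upper_env_opp lower_env_opp -gradN// -hessN//.
have [limsup_le le_liminf] := consG _ (C2N C2phi) x.
by split; rewrite leeN2; [exact: le_liminf|exact: limsup_le].
Qed.

Lemma nearly_monotone_opp (G : scheme Omega) :
  nearly_monotone G -> nearly_monotone (opp_scheme G).
Proof.
have bndN (v : closure Omega -> R) :
    bounded_fun v -> bounded_fun (fun y => - v y).
  exact: bounded_funN.
move=> [GM [GN [GM_mono [m [m_ge0 m0 GN_le]] GE]]].
exists (opp_scheme GM), (opp_scheme GN); split.
- move=> e e0 x s v w bndv bndw wv; rewrite lerN2.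
  by apply: GM_mono => // [||y]; [exact: bndN|exact: bndN|rewrite lerN2].
- exists m; split=> // e e0 v bndv x.
  by rewrite apply_scheme_opp normrN; apply: GN_le => //; exact: bndN.
- move=> e e0 v bndv x; rewrite !apply_scheme_opp -opprD GE//; exact: bndN.
Qed.

End Duality.

Section Convergence.
Context {R : realType} {d : nat} {Omega : set 'rV[R]_d}.
Implicit Types (F : closure Omega -> R -> 'rV[R]_d -> 'M[R]_d -> R).
Implicit Types (G : scheme Omega) (ue : R -> closure Omega -> R) (M : R).

Definition bounded_solution G ue M := forall e : R, 0 < e ->
  [/\ continuous (ue e), forall x, apply_scheme G e (ue e) x = 0 &
      forall x, `|ue e x| <= M].

Lemma bounded_solution_opp G ue M : bounded_solution G ue M ->
  bounded_solution (opp_scheme G) (fun e x => - ue e x) M.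
Proof.
move=> sol e /sol[cue Gue ueM]; split=> x; last by rewrite normrN.
  exact: (cvgN (cue x)).
rewrite apply_scheme_opp; under eq_fun do rewrite opprK.
by rewrite Gue oppr0.
Qed.

Lemma bounded_solution_near G ue M : bounded_solution G ue M ->
  \forall e \near 0^'+, forall x, `|ue e x| <= M.
Proof.
by move=> sol; apply: filterS (nbhs_right_gt 0) => e /sol[].
Qed.

Lemma nearly_monotone_le G : nearly_monotone G ->
  exists2 m : R -> R, m @ 0^'+ --> 0 &
    forall (e : R) (v w : closure Omega -> R) x,
      0 < e -> bounded_fun v -> bounded_fun w ->
      (forall y, v y <= w y) -> v x = w x ->
      apply_scheme G e w x <= apply_scheme G e v x + m e.
Proof.
move=> [GM [GN [GM_mono [m [_ m0 GN_le]] GE]]].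
exists (fun e => m e + m e).
  by rewrite -[X in _ --> X](addr0 0); exact: cvgD.
move=> e v w x e0 bndv bndw vw vwx; rewrite !GE//.
have : apply_scheme GM e w x <= apply_scheme GM e v x.
  by rewrite /apply_scheme vwx; exact: GM_mono.
have := GN_le e e0 v bndv x; have := GN_le e e0 w bndw x.
by rewrite !ler_norml; lra.
Qed.

Lemma test_value_touching_le G ue M :
  bounded_set Omega -> nearly_monotone G -> bounded_solution G ue M ->
  exists2 m : R -> R, m @ 0^'+ --> 0 &
    forall phi e (y : closure Omega) xi, 0 < e -> continuous phi ->
      ue e y = phi (set_val y) + xi ->
      (forall z : closure Omega, ue e z <= phi (set_val z) + xi) ->
      (test_value G phi (e, y, xi) <= (m e)%:E)%E.
Proof.
move=> /compact_closure_type cptO /nearly_monotone_le[m m0 G_le] sol.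
exists m => // phi e y xi e0 cphi uey ue_le.
have [cue Gue _] := sol e e0.
have bnd_ue := compact_bounded_fun cptO cue.
have bnd_shift : bounded_fun (fun z : closure Omega => phi (set_val z) + xi).
  apply: compact_bounded_fun cptO _ => z.
  exact: (cvgD (continuous_comp_set_val cphi (x := z)) (cvg_cst xi)).
have := G_le e _ _ y e0 bnd_ue bnd_shift ue_le uey.
by rewrite Gue add0r lee_fin.
Qed.

Lemma relaxed_limsup_subsolution F G ue M :
  bounded_set Omega -> consistent F G -> nearly_monotone G ->
  bounded_solution G ue M -> subsolution F (relaxed_limsup 0^'+ ue).
Proof.
move=> bndO consG monoG sol.
have cptO := compact_closure_type bndO.
have ueM := bounded_solution_near sol.
have [m m0 touching_le] := test_value_touching_le bndO monoG sol.
apply: subsolution_strict_test => //.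
- exact: relaxed_limsup_usc ueM.
- by apply/bounded_fun_leP; exists M => x; exact: normr_relaxed_limsup ueM x.
move=> phi x C2phi ux u_lt; have cphi := C2_continuous C2phi.
rewrite ux; apply: le_trans (consG _ C2phi x).2 _.
apply/lee_addgt0Pr => delta delta0; rewrite add0e.
apply: limf_einf_le => P nearP.
have near_m : \forall e \near 0^'+, m e <= delta /\ 0 < e.
  by apply: filterI; [exact: (cvgr_le _ m0)|exact: nbhs_right_gt].
have cue : \forall e \near 0^'+, continuous (ue e).
  by apply: filterS (nbhs_right_gt 0) => e /sol[].
pose L := filter_prod (filter_prod (0 : R)^'+ (nbhs x)) (nbhs (0 : R)).
have cvg_eps : w.1.1 @[w --> L] --> (0 : R)^'+.
  exact: cvg_comp cvg_fst cvg_fst.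
have near_Pm : L [set w | P w /\ (m w.1.1 <= delta /\ 0 < w.1.1)].
  by apply: filterI => //; exact: cvg_eps near_m.
have [e [y [xi [[Pw [me e0]] uey ue_le]]]] := relaxed_limsup_strict_max ueM cptO
  cue (continuous_comp_set_val cphi) ux u_lt near_Pm.
exists (e, y, xi) => //.
apply: le_trans (touching_le phi e y xi e0 cphi uey ue_le) _.
by rewrite lee_fin.
Qed.

Lemma relaxed_liminf_supersolution F G ue M :
  bounded_set Omega -> consistent F G -> nearly_monotone G ->
  bounded_solution G ue M -> supersolution F (relaxed_liminf 0^'+ ue).
Proof.
move=> bndO consG monoG sol; apply: supersolution_opp.
rewrite /relaxed_liminf; under eq_fun do rewrite opprK.
exact: relaxed_limsup_subsolution bndO (consistent_opp consG)
  (nearly_monotone_opp monoG) (bounded_solution_opp sol).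
Qed.

End Convergence.

Theorem theorem1 (R : realType) (d : nat) (Omega : set 'rV[R]_d)
    (F : closure Omega -> R -> 'rV[R]_d -> 'M[R]_d -> R)
    (g : boundary Omega -> R)
    (u : closure Omega -> R)
    (G : scheme Omega)
    (ue : R -> closure Omega -> R) :
  open Omega ->
  bounded_set Omega ->
  degenerate_elliptic F ->
  dirichlet F g ->
  comparison_principle F ->
  viscosity_solution F u ->
  consistent F G ->
  nearly_monotone G ->
  (forall e : R, 0 < e -> continuous (ue e)) ->
  (forall e : R, 0 < e -> forall x, apply_scheme G e (ue e) x = 0) ->
  stable ue ->
  cvg_locally_uniformly ue u.
Proof.
move=> _ bndO _ _ comp [subu superu] consG monoG cue Gue [M ueM] x.
have sol : bounded_solution G ue M.
  by move=> e e0; split; [exact: cue|exact: Gue|exact: ueM].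
have limsup_sub := relaxed_limsup_subsolution bndO consG monoG sol.
have liminf_super := relaxed_liminf_supersolution bndO consG monoG sol.
exists setT; first exact: filterT.
apply: cvg_uniform_relaxed (compact_closure_type bndO)
  (bounded_solution_near sol) superu.1 subu.1 _ _.
  exact: comp limsup_sub superu.
exact: comp subu liminf_super.
Qed.
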